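(* Let $X$ be a non-empty locally compact Hausdorff space. Then $C_{\mathrm{BSE}}(X):=C_{\mathrm{BSE}}(\Delta(C_0(X)))$, with the norm $\|\cdot\|_{\mathrm{BSE}}$, is a unital Banach function algebra on $X$, and its character space is homeomorphic to $\overline{X}^{w^*}$, that is, $$\Delta(C_{\mathrm{BSE}}(X))=\overline{\{\phi_x : x\in X\}}^{w^*},$$ where $\phi_x$ denotes the point evaluation $\phi_x(\sigma)=\sigma(x)$ at $x\in X$, and the closure is taken in the weak$^*$ topology of the dual space of $C_{\mathrm{BSE}}(X)$.
   Context: All algebras are over $\mathbb{C}$. For a commutative Banach algebra $A$, $\Delta(A)$ (the character space) is the set of all non-zero homomorphisms $A\to\mathbb{C}$, with the relative weak$^*$ (Gelfand) topology from $A^*$. $C_b(Y)$ denotes the algebra of bounded continuous complex-valued functions on a topological space $Y$, with pointwise operations. For a semi-simple commutative Banach algebra $A$, a function $\sigma\in C_b(\Delta(A))$ is a BSE-function if there is a constant $C>0$ such that for all $\phi_1,\dots,\phi_n\in\Delta(A)$ and all $c_1,\dots,c_n\in\mathbb{C}$, $$\left|\sum_{i=1}^n c_i\sigma(\phi_i)\right|\le C\left\|\sum_{i=1}^n c_i\phi_i\right\|_{A^*}.$$ $C_{\mathrm{BSE}}(\Delta(A))$ is the set of all BSE-functions, and $\|\sigma\|_{\mathrm{BSE}}$ is the infimum of all such constants $C$. For a locally compact Hausdorff space $X$, $C_0(X)$ is the Banach algebra of continuous complex functions on $X$ vanishing at infinity, with the supremum norm. $\Delta(C_0(X))$ is identified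 with $X$ via point evaluations, so elements of $C_{\mathrm{BSE}}(X)$ are regarded as functions in $C_b(X)$. A function algebra on $X$ is a subalgebra $B$ of $C_b(X)$ that separates strongly the points of $X$: for all $x\neq y$ in $X$ there is $f\in B$ with $f(x)\ne f(y)$, and for each $x\in X$ there is $f\in B$ with $f(x)\neq 0$. A Banach function algebra (BFA) on $X$ is a function algebra $B$ on $X$ with a norm $\|\cdot\|$ such that $(B,\|\cdot\|)$ is a Banach algebra. *)

(* Defs.v *)
From HB Require Import structures.
From mathcomp Require Import all_boot all_order all_algebra.
From mathcomp Require Import all_classical all_reals all_analysis.
From mathcomp Require Import complex ring.

Set Implicit Arguments.
Unset Strict Implicit.
Unset Printing Implicit Defensive.
Import Order.TTheory GRing.Theory Num.Theory.
Import numFieldNormedType.Exports.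
Local Open Scope classical_set_scope.
Local Open Scope ring_scope.

(* [R[i]] under a name whose head is a [numClosedFieldType], which is what
   gives it the topology and the norm of [numFieldNormedType]. *)
Definition Cplx (R : realType) : numClosedFieldType := R[i].

Section modulus.
Variable R : realType.
Local Notation C := (Cplx R).

Definition RtoC (r : R) : C := r%:C%C.

(* The norm of [C] takes its values in [C]; this is the same number in [R]. *)
Definition cmod (z : C) : R := complex.Re `|z|.

Lemma cmodE z : `|z| = RtoC (cmod z).
Proof. by rewrite /RtoC /cmod RRe_real// normr_real. Qed.

Lemma RtoC_le r s : (RtoC r <= RtoC s) = (r <= s).
Proof. exact: lecR. Qed.

Lemma RtoC_lt r s : (RtoC r < RtoC s) = (r < s).
Proof. exact: ltcR. Qed.

Lemma RtoCD r s : RtoC (r + s) = RtoC r + RtoC s.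
Proof. exact: rmorphD. Qed.

Lemma RtoCM r s : RtoC (r * s) = RtoC r * RtoC s.
Proof. exact: rmorphM. Qed.

Lemma RtoC_inj : injective RtoC.
Proof. by move=> r s []. Qed.

Lemma cmod_ge0 z : 0 <= cmod z.
Proof. by rewrite -RtoC_le -cmodE; exact: normr_ge0. Qed.

Lemma cmodD z w : cmod (z + w) <= cmod z + cmod w.
Proof. by rewrite -RtoC_le RtoCD -!cmodE; exact: ler_normD. Qed.

Lemma cmodM z w : cmod (z * w) = cmod z * cmod w.
Proof. by apply: RtoC_inj; rewrite RtoCM -!cmodE; exact: normrM. Qed.

Lemma cmod_eq0 z : cmod z = 0 -> z = 0.
Proof. by move=> z0; apply/normr0_eq0; rewrite cmodE z0. Qed.

Lemma cmod0 : cmod 0 = 0.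
Proof. by apply: RtoC_inj; rewrite -cmodE normr0. Qed.

Lemma cmod1 : cmod 1 = 1.
Proof. by apply: RtoC_inj; rewrite -cmodE normr1. Qed.

End modulus.
Arguments cmod {R} z.

(* Commutative normed algebras, not assumed to be unital; [amul] is needed
   because the library's rings and algebras have a unit. *)
HB.mixin Record NormedModule_isCommNormedAlg (K : numFieldType) A
    of NormedModule K A := {
  amul : A -> A -> A;
  amulA : associative amul;
  amulC : commutative amul;
  amulDl : left_distributive amul +%R;
  amulZl : forall (k : K) x y, amul (k *: x) y = k *: amul x y;
  norm_amul_le : forall x y, `|amul x y| <= `|x| * `|y| }.

#[short(type="commNormedAlgType")]
HB.structure Definition CommNormedAlg (K : numFieldType) :=
  { A of NormedModule_isCommNormedAlg K A & NormedModule K A }.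

Definition Cb (R : realType) (Y : topologicalType) : set (Y -> Cplx R) :=
  [set f | continuous f /\ bounded_fun f].
Arguments Cb : clear implicits.

Section characters.
Variables (R : realType) (A : commNormedAlgType (Cplx R)).
Local Notation C := (Cplx R).

(* Unital in the usual sense for Banach algebras: the identity has norm 1. *)
Definition unital := exists e : A, (forall a, amul e a = a) /\ `|e| = 1.

(* The weak* topology of [A^*] is the topology of pointwise convergence on
   [A], whence [{ptws A -> C}]. *)
Definition dual : set {ptws A -> C} := [set f : A -> C | scalar f /\ continuous f].

(* As in the definition of the character space, continuity is not required: it
   is automatic on a Banach algebra. Coerced to a type, [char_space] carries the
   subspace topology of [{ptws A -> C}], which is the Gelfand topology. *)
Definition char_space : set {ptws A -> C} :=
  [set f : A -> C | [/\ scalar f, {morph f : a b / amul a b >-> a * b}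
             & exists a, f a <> 0]].

(* The closure is taken inside the space [dual], with its subspace topology. *)
Definition weak_star_closure (S : set {ptws A -> C}) : set {ptws A -> C} :=
  [set val f | f in closure [set f : dual | S (val f)]].

(* Valued in [\bar R] because nothing here forces [f] to be bounded. *)
Definition dual_norm (f : A -> C) : \bar R :=
  ereal_sup [set (cmod (f a))%:E | a in [set a : A | `|a| <= 1]].

Definition BSE_bound (sigma : char_space -> C) (K : R) :=
  0 < K /\ forall (n : nat) (phi : 'I_n -> char_space) (c : 'I_n -> C),
    ((cmod (\sum_(i < n) c i * sigma (phi i)))%:E <=
      K%:E * dual_norm (fun a => \sum_(i < n) c i * val (phi i) a)%R)%E.

Definition BSE_function (sigma : char_space -> C) :=
  Cb R char_space sigma /\ exists K, BSE_bound sigma K.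

Definition BSE_norm (sigma : char_space -> C) : R :=
  inf [set K | BSE_bound sigma K].

End characters.
Arguments char_space {R} A.
Arguments dual {R} A.

Section function_algebras.
Variables (R : realType) (X : Type).
Local Notation C := (Cplx R).

(* An algebra of functions [B] with an algebra norm [N], of which only the
   values on [B] matter; [0 <= N f] follows from [nnormD] and [nnormZ]. *)
Record normed_subalgebra (B : set (X -> C)) (N : (X -> C) -> R) : Prop := {
  nsub0 : B 0;
  nsubD : forall f g, B f -> B g -> B (f + g);
  nsubZ : forall (c : C) f, B f -> B (c *: f);
  nsubM : forall f g, B f -> B g -> B (f * g);
  nnormD : forall f g, B f -> B g -> N (f + g) <= N f + N g;
  nnormZ : forall (c : C) f, B f -> N (c *: f) = cmod c * N f;
  nnorm0 : forall f, B f -> N f = 0 -> f = 0;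
  nnormM : forall f g, B f -> B g -> N (f * g) <= N f * N g }.

(* [B] as a type, normed by [N] and with pointwise operations. *)
Definition fun_alg B N of @normed_subalgebra B N := set_type B.

Section instances.
Variables (B : set (X -> C)) (N : (X -> C) -> R) (h : normed_subalgebra B N).
Implicit Types f g : fun_alg h.

HB.instance Definition _ := SubChoice.copy (fun_alg h) (set_type B).

Lemma fun_alg_closed : subsemimod_closed (mem B).
Proof.
split; last by move=> c f; rewrite !inE; exact: nsubZ h _ _.
split; first by rewrite inE; exact: nsub0 h.
by move=> f g; rewrite !inE; exact: nsubD h _ _.
Qed.

HB.instance Definition _ :=
  GRing.SubChoice_isSubLmodule.Build C (X -> C) (mem B) (fun_alg h)
    fun_alg_closed.

Lemma fun_algP f : B (val f).
Proof. exact: set_valP. Qed.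

Lemma fun_alg_normD f g :
  RtoC (N (val (f + g))) <= RtoC (N (val f)) + RtoC (N (val g)).
Proof.
by rewrite -RtoCD RtoC_le raddfD; apply: nnormD h _ _ _ _; exact: fun_algP.
Qed.

Lemma fun_alg_normZ (c : C) f :
  RtoC (N (val (c *: f))) = `|c| * RtoC (N (val f)).
Proof.
by rewrite cmodE -RtoCM linearZ; congr RtoC; apply: nnormZ h _ _ _; exact: fun_algP.
Qed.

Lemma fun_alg_norm0 f : RtoC (N (val f)) = 0 -> f = 0.
Proof.
move=> /(@RtoC_inj _ _ 0) f0; apply: val_inj; rewrite raddf0.
by apply: nnorm0 h _ _ f0; exact: fun_algP.
Qed.

HB.instance Definition _ := Lmodule_isNormed.Build C (fun_alg h)
  fun_alg_normD fun_alg_normZ fun_alg_norm0.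

Lemma fun_alg_normE f : `|f| = RtoC (N (val f)).
Proof. by []. Qed.

Lemma fun_alg_mul_subproof f g : val f * val g \in B.
Proof. by rewrite inE; apply: nsubM h _ _ _ _; exact: fun_algP. Qed.

Definition fun_alg_mul f g : fun_alg h :=
  Sub (val f * val g) (fun_alg_mul_subproof f g).

Lemma fun_alg_mulE f g : val (fun_alg_mul f g) = val f * val g.
Proof. by []. Qed.

Lemma fun_alg_mulA : associative fun_alg_mul.
Proof. by move=> f g k; apply: val_inj; rewrite !fun_alg_mulE mulrA. Qed.

Lemma fun_alg_mulC : commutative fun_alg_mul.
Proof. by move=> f g; apply: val_inj; rewrite !fun_alg_mulE mulrC. Qed.

Lemma fun_alg_mulDl : left_distributive fun_alg_mul +%R.
Proof.
by move=> f g k; apply: val_inj; rewrite raddfD !fun_alg_mulE raddfD mulrDl.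
Qed.

Lemma fun_alg_mulZl (c : C) f g : fun_alg_mul (c *: f) g = c *: fun_alg_mul f g.
Proof.
apply: val_inj; rewrite linearZ !fun_alg_mulE linearZ.
by apply/funext => x; exact: (esym (mulrA _ _ _)).
Qed.

Lemma fun_alg_mul_norm f g : `|fun_alg_mul f g| <= `|f| * `|g|.
Proof.
rewrite !fun_alg_normE -RtoCM RtoC_le fun_alg_mulE.
by apply: nnormM h _ _ _ _; exact: fun_algP.
Qed.

HB.instance Definition _ :=
  NormedModule_isCommNormedAlg.Build C (fun_alg h) fun_alg_mulA fun_alg_mulC
    fun_alg_mulDl fun_alg_mulZl fun_alg_mul_norm.

End instances.

Definition point_eval B N (h : @normed_subalgebra B N) (x : X) :
  {ptws fun_alg h -> C} := fun f => val f x.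

End function_algebras.
Arguments point_eval {R X B N} h x _.

Record banach_function_algebra (R : realType) (X : topologicalType)
    (B : set (X -> Cplx R)) (N : (X -> Cplx R) -> R) : Prop := {
  bfa_normed :> normed_subalgebra B N;
  bfa_Cb : B `<=` Cb R X;
  bfa_separates : forall x y, x <> y -> exists2 f, B f & f x <> f y;
  bfa_nonvanishing : forall x, exists2 f, B f & f x <> 0;
  bfa_complete : forall F : set_system (fun_alg bfa_normed),
    ProperFilter F -> cauchy F -> cvg F }.

Section cmod_continuous.
Variables (R : realType) (X : topologicalType).
Local Notation C := (Cplx R).
Implicit Types f : X -> C.

Lemma cmod_near f x (e : R) : continuous f -> 0 < e ->
  \forall y \near x, cmod (f x - f y) < e.
Proof.
move=> cf e0; have /cvgrPdist_lt /(_ (RtoC e)) := cf x.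
rewrite -[0]/(RtoC 0) RtoC_lt => /(_ e0); apply: filterS => y.
by rewrite cmodE RtoC_lt.
Qed.

Lemma cmod_dist (z w : C) : `|cmod z - cmod w| <= cmod (z - w).
Proof.
have le (z1 z2 : C) : cmod z1 - cmod z2 <= cmod (z1 - z2).
  by rewrite lerBlDr (le_trans _ (cmodD _ _))// subrK.
rewrite ler_norml lerNl opprB le andbT.
suff <- : cmod (w - z) = cmod (z - w) by exact: le.
by apply: RtoC_inj; rewrite -!cmodE distrC.
Qed.

Lemma continuous_cmod f : continuous f -> continuous (cmod \o f : X -> R).
Proof.
move=> cf x; apply/cvgrPdist_lt => e e0.
apply: filterS (cmod_near x cf e0) => y; exact/le_lt_trans/cmod_dist.
Qed.

Lemma closed_cmod_ge f (e : R) : continuous f -> closed [set x | e <= cmod (f x)].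
Proof.
move=> /continuous_cmod cf.
apply: (@preimage_closed _ _ (cmod \o f) [set r : R | e <= r]).
  by move=> x _; exact: cf.
exact: closed_ge.
Qed.

End cmod_continuous.

Section C0.
Variables (R : realType) (X : topologicalType).
Local Notation C := (Cplx R).
Implicit Types f g : X -> C.

Definition C0 : set (X -> C) :=
  [set f | continuous f /\
           forall e : R, 0 < e -> compact [set x | e <= cmod (f x)]].

Definition sup_norm f : R := sup (range (cmod \o f)).

Lemma C0_dom f : continuous f ->
  (forall e : R, 0 < e ->
    exists2 K, compact K & [set x | e <= cmod (f x)] `<=` K) -> C0 f.
Proof.
move=> cf fK; split => // e /fK[K cK fe]; apply: subclosed_compact cK fe.
exact: closed_cmod_ge.
Qed.

Lemma C0_bounded f : C0 f -> has_ubound (range (cmod \o f)).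
Proof.
move=> [cf /(_ 1 ltr01) cK].
have cmf : {within [set x | 1 <= cmod (f x)], continuous (cmod \o f : X -> R)}.
  exact/continuous_subspaceT/continuous_cmod.
have [M [_ bM]] := compact_bounded (continuous_compact cmf cK).
exists (Num.max 1 (M + 1)) => _ [x _ <-] /=; rewrite le_max.
case: (leP (cmod (f x)) 1) => //= /ltW fx1.
rewrite -[leLHS]ger0_norm ?cmod_ge0//; apply: bM; first by rewrite ltrDl.
by exists x.
Qed.

Lemma sup_norm_ub f x : C0 f -> cmod (f x) <= sup_norm f.
Proof. by move=> /C0_bounded fb; apply: (ub_le_sup fb); exists x. Qed.

Lemma sup_norm_ge0 f : 0 <= sup_norm f.
Proof.
rewrite /sup_norm; have [[[r [x xX fx]] fb]|/sup_out->//] :=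
  pselect (has_sup (range (cmod \o f))).
by rewrite (le_trans (cmod_ge0 (f x)))//; apply: (ub_le_sup fb); exists x.
Qed.

Lemma sup_norm_le f (M : R) : 0 <= M -> (forall x, cmod (f x) <= M) ->
  sup_norm f <= M.
Proof.
move=> M0 fM; have [[r rf]|/set0P/negP] := pselect (range (cmod \o f) !=set0).
  by apply: ge_sup; [exists r|move=> _ [x _ <-]; exact: fM].
by rewrite negbK => /eqP; rewrite /sup_norm => ->; rewrite sup0.
Qed.

Lemma C00 : C0 0.
Proof.
apply: C0_dom => [x|e e0]; first exact: cvg_cst.
by exists set0; [exact: compact0|move=> x /=; rewrite cmod0 leNgt e0].
Qed.

Lemma C0D f g : C0 f -> C0 g -> C0 (f + g).
Proof.
move=> [cf f0] [cg g0]; apply: C0_dom => [x|e e0].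
  by apply: cvgD; [exact: cf|exact: cg].
have e20 : 0 < e / 2 by rewrite divr_gt0.
exists ([set x | e / 2 <= cmod (f x)] `|` [set x | e / 2 <= cmod (g x)]).
  by apply: compactU; [exact: f0|exact: g0].
move=> x /= fgx; case: (leP (e / 2) (cmod (f x))) => [|fx]; [by left|right].
rewrite leNgt; apply/negP => gx; move: fgx; rewrite leNgt => /negP; apply.
by rewrite (le_lt_trans (cmodD _ _))// [e]splitr ltrD.
Qed.

Lemma C0M f g : continuous f -> has_ubound (range (cmod \o f)) -> C0 g ->
  C0 (f * g).
Proof.
move=> cf [M fM] [cg g0]; apply: C0_dom => [x|e e0].
  by apply: cvgM; [exact: cf|exact: cg].
pose M1 := Num.max M 1.
have M0 : 0 < M1 by rewrite lt_max ltr01 orbT.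
exists [set x | e / M1 <= cmod (g x)]; first by apply: g0; exact: divr_gt0.
move=> x /=; rewrite cmodM ler_pdivrMr// => /le_trans; apply.
rewrite mulrC ler_wpM2l// ?cmod_ge0// le_max; apply/orP; left.
by apply: fM; exists x.
Qed.

Lemma C0Z (c : C) f : C0 f -> C0 (c *: f).
Proof.
move=> f0; rewrite (_ : c *: f = cst c * f)//; apply: C0M => //.
  by move=> x; exact: cvg_cst.
by exists (cmod c) => _ [x _ <-].
Qed.

Lemma sup_normZ (c : C) f : C0 f -> sup_norm (c *: f) = cmod c * sup_norm f.
Proof.
have le (d : C) g : C0 g -> sup_norm (d *: g) <= cmod d * sup_norm g.
  move=> g0; apply: sup_norm_le => [|x].
    by rewrite mulr_ge0 ?cmod_ge0 ?sup_norm_ge0.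
  by rewrite [leLHS]cmodM ler_wpM2l ?cmod_ge0// sup_norm_ub.
move=> f0; have [->|c0] := eqVneq c 0.
  rewrite scale0r cmod0 mul0r; apply/le_anti; rewrite sup_norm_ge0 andbT.
  by apply: sup_norm_le => // x; rewrite cmod0.
apply/le_anti; rewrite le//=.
have cc0 : 0 < cmod c.
  by rewrite lt_def cmod_ge0 andbT; apply: contra_neq c0 => /cmod_eq0.
rewrite -ler_pdivlMl//.
have {1}-> : f = c^-1 *: (c *: f) by rewrite scalerA mulVf// scale1r.
rewrite (le_trans (le _ _ (C0Z _ f0)))// ler_wpM2r ?sup_norm_ge0//.
by rewrite -(ler_pM2l cc0) -cmodM mulfV// cmod1 mulfV// gt_eqF.
Qed.

Lemma C0_normed_subalgebra : normed_subalgebra C0 sup_norm.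
Proof.
split.
- exact: C00.
- exact: C0D.
- by move=> c f; exact: C0Z.
- by move=> f g f0; apply: C0M; [exact: f0.1|exact: C0_bounded].
- move=> f g f0 g0; apply: sup_norm_le => [|x].
    by rewrite addr_ge0 ?sup_norm_ge0.
  by rewrite (le_trans (cmodD _ _))// lerD// sup_norm_ub.
- by move=> c f; exact: sup_normZ.
- move=> f f0 fn0; apply/funext => x; apply/cmod_eq0/le_anti.
  by rewrite cmod_ge0 andbT -fn0 sup_norm_ub.
- move=> f g f0 g0; apply: sup_norm_le => [|x].
    by rewrite mulr_ge0 ?sup_norm_ge0.
  by rewrite [leLHS]cmodM ler_pM ?cmod_ge0// sup_norm_ub.
Qed.

End C0.

Section C0_characters.
Variables (R : realType) (X : topologicalType).
Local Notation C := (Cplx R).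

Definition C0_alg := fun_alg (@C0_normed_subalgebra R X).

Section character.
Variable phi : C0_alg -> C.
Hypothesis phi_char : char_space C0_alg phi.
Implicit Types f g h : C0_alg.

Let phiL : scalar phi. Proof. by case: phi_char. Qed.
Let phiM : {morph phi : f g / amul f g >-> f * g}. Proof. by case: phi_char. Qed.

Let phi0 : phi 0 = 0.
Proof. by have := phiL (-1) 0 0; rewrite scaler0 addr0 mulN1r addNr. Qed.

Let phiD f g : phi (f + g) = phi f + phi g.
Proof. by have := phiL 1 f g; rewrite scale1r mul1r. Qed.

Let phiZ (c : C) f : phi (c *: f) = c * phi f.
Proof. by have := phiL c f 0; rewrite !addr0 phi0 addr0. Qed.

Let phiB f g : phi (f - g) = phi f - phi g.
Proof. by rewrite -scaleN1r phiD phiZ mulN1r. Qed.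

Let valM f g x : val (amul f g) x = val f x * val g x. Proof. by []. Qed.
Let valD f g x : val (f + g) x = val f x + val g x. Proof. by []. Qed.
Let valB f g x : val (f - g) x = val f x - val g x. Proof. by []. Qed.
Let valZ (c : C) f x : val (c *: f) x = c * val f x. Proof. by []. Qed.

Let lift (f : X -> C) : C0 f -> {g : C0_alg | val g = f}.
Proof. by rewrite -in_setE => f0; exists (Sub f f0). Qed.

Let conj_lift f : {g : C0_alg | forall x, val g x = (val f x)^*}.
Proof.
suff cC : C0 (fun x => (val f x)^*) by have [g gE] := lift cC; exists g; rewrite gE.
have [cf f0] : C0 (val f) := fun_algP f.
have E z : cmod (z^* : C) = cmod z by apply: RtoC_inj; rewrite -!cmodE norm_conjC.
apply: C0_dom => [x|e /f0 ?]; last first.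
  by exists [set x | e <= cmod (val f x)] => // x /=; rewrite E.
apply/cvgrPdist_lt => e e0; have /cvgrPdist_lt /(_ e e0) := cf x.
by apply: filterS => y; rewrite -rmorphB norm_conjC.
Qed.

(* A character that vanishes on the functions vanishing at a point of the
   non-zero set of [g] is the evaluation at that point. *)
Let eval_of_ker g x : phi g = 1 -> val g x <> 0 ->
  (forall f, phi f = 0 -> val f x = 0) -> forall f, phi f = val f x.
Proof.
move=> g1 gx ker.
have gE f : val f x = phi f * val g x.
  apply/subr0_eq; rewrite -valZ -valB; apply: ker.
  by rewrite phiB phiZ g1 mulr1 subrr.
suff gx1 : val g x = 1 by move=> f; rewrite gE gx1 mulr1.
apply: (mulfI (x := val g x)); first exact/eqP.
by rewrite -valM gE phiM g1 !mulr1 mul1r.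
Qed.

Lemma C0_char_eval : exists x, forall f, phi f = val f x.
Proof.
apply: contrapT => neval.
have [a a0] : exists a, phi a <> 0 by case: phi_char.
have [g g1] : exists g, phi g = 1.
  by exists ((phi a)^-1 *: a); rewrite phiZ mulVf//; apply/eqP.
have {neval a a0} ker x : val g x <> 0 -> exists2 f, phi f = 0 & val f x <> 0.
  move=> gx; apply: contrapT => nf; apply: neval; exists x.
  apply: eval_of_ker g1 gx _ => f f0; apply: contrapT => fx.
  by apply: nf; exists f.
pose P := [set h | phi h = 0 /\ forall x, 0 <= val h x].
have P0 : P 0 by split.
have PD h1 h2 : P h1 -> P h2 -> P (h1 + h2).
  move=> [h10 h1p] [h20 h2p]; split; first by rewrite phiD h10 h20 addr0.
  by move=> x; rewrite valD addr_ge0.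
have {}ker x : val g x <> 0 -> exists2 h, P h & val h x <> 0.
  move=> /ker[f f0 /eqP fx]; have [f' f'E] := conj_lift f.
  exists (amul f f'); first split; first by rewrite phiM f0 mul0r.
    by move=> y; rewrite valM f'E mul_conjC_ge0.
  by rewrite valM f'E; apply/eqP; rewrite mulf_neq0// conjC_eq0.
pose K := [set x | 2^-1 <= cmod (val g x)].
have cK : compact K by have [_] : C0 (val g) := fun_algP g; apply; rewrite invr_gt0.
have [h [h0 hp] hK] : exists2 h, P h & forall x, K x -> val h x <> 0.
  apply: contrapT => nh.
  pose Z h := K `&` [set x | val h x = 0].
  have ZF : ProperFilter (filter_from P Z).
    apply: filter_from_proper => [|h Ph].
      apply: filter_from_filter; first by exists 0.
      move=> h1 h2 Ph1 Ph2; exists (h1 + h2); first exact: PD.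
      move=> x [Kx hx]; have /eqP : val h1 x + val h2 x = 0 by exact: hx.
      rewrite paddr_eq0; [|exact: Ph1.2|exact: Ph2.2].
      by move=> /andP[/eqP h1x /eqP h2x].
    apply: contrapT => /set0P/negP; rewrite negbK => /eqP Zh0.
    apply: nh; exists h => // x Kx hx.
    by have : Z h x by []; rewrite Zh0.
  have [|x [Kx clx]] := cK _ ZF; first by exists 0 => // x [].
  have gx : val g x <> 0.
    by move: Kx => /[swap]; rewrite /K/= => ->; rewrite cmod0 leNgt invr_gt0 ltr0n.
  have [h Ph /eqP hx] := ker x gx.
  have hx0 : 0 < cmod (val h x).
    by rewrite lt_def cmod_ge0 andbT; apply: contra_neq hx => /cmod_eq0.
  have [ch _] : C0 (val h) := fun_algP h.
  have [|y [[_ hy]]] := clx (Z h) _ _ (cmod_near x ch hx0); first by exists h.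
  by rewrite /= hy subr0 ltxx.
have [g' g'E] := conj_lift g.
pose k := amul g' g - g' - g + h.
have phik : phi k = -1.
  rewrite /k phiD !phiB phiM g1 h0 mulr1 subrr sub0r addr0//.
have kE x : 1 + val k x = `|1 - val g x| ^+ 2 + val h x.
  rewrite /k valD !valB valM g'E normCK rmorphB rmorph1.
  by rewrite addrA; congr (_ + _); ring.
clearbody k; have k0 x : 1 + val k x != 0.
  rewrite kE paddr_eq0 ?exprn_ge0//; apply/negP => /andP[+ /eqP hx].
  rewrite sqrf_eq0 normr_eq0 subr_eq0 => /eqP g1x.
  apply: (hK x) hx; rewrite /K/= -g1x cmod1.
  by rewrite invf_le1 ?ler1n ?ltr0n.
have uC : C0 (fun x => - val k x / (1 + val k x)).
  have [ck k0'] : C0 (val k) := fun_algP k.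
  apply: C0_dom => [x|e e0].
    apply: cvgM; first by apply: cvgN; exact: ck.
    by apply: cvgV => //; apply: cvgD; [exact: cvg_cst|exact: ck].
  have e40 : 0 < e / 4 by rewrite divr_gt0.
  exists (K `|` [set x | e / 4 <= cmod (val k x)]).
    by apply: compactU => //; exact: k0'.
  move=> x /= ux; have [Kx|nKx] := pselect (K x); [by left|right].
  have k4 : 4^-1 <= cmod (1 + val k x).
    rewrite -RtoC_le -cmodE kE ger0_norm ?addr_ge0 ?exprn_ge0//.
    rewrite (@le_trans _ _ (`|1 - val g x| ^+ 2))//; last by rewrite lerDl.
    rewrite cmodE expr2 -RtoCM RtoC_le (_ : 4^-1 = 2^-1 * 2^-1); last first.
      by rewrite -invfM -natrM.
    have : 2^-1 <= cmod (1 - val g x).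
      move/negP: nKx; rewrite /K/= -ltNge => /ltW gx.
      have := cmodD (1 - val g x) (val g x); rewrite subrK cmod1 => /le_trans h1.
      have : 1 <= cmod (1 - val g x) + 2^-1 by apply: h1; rewrite lerD2l.
      by rewrite -lerBlDr {1}[1]splitr div1r addrK.
    by move=> h2; rewrite ler_pM ?invr_ge0.
  rewrite /= (le_trans (ler_wpM2l (ltW e0) k4))//.
  have := ler_wpM2r (cmod_ge0 (1 + val k x)) ux.
  rewrite -cmodM divfK ?k0//.
  rewrite (_ : cmod (- val k x) = cmod (val k x))//.
  by apply: RtoC_inj; rewrite -!cmodE normrN.
have [u uE] := lift uC; have : k + u + amul k u = 0.
  apply: val_inj; apply/funext => x; rewrite !valD valM uE.
  rewrite -[RHS]/0; field; exact: k0.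
move=> /(congr1 phi); rewrite !phiD phiM phik phi0 mulN1r addrK.
by move/eqP; rewrite oppr_eq0 oner_eq0.
Qed.

End character.

(* The identification of the character space of [C0] with [X]: each character
   is the evaluation at the point [C0_point phi]. When [X] is locally compact
   and Hausdorff this point is unique and every point is obtained. *)
Definition C0_point (phi : char_space C0_alg) : X :=
  projT1 (cid (C0_char_eval (set_valP phi))).

Lemma C0_pointE (phi : char_space C0_alg) :
  val phi = point_eval (@C0_normed_subalgebra R X) (C0_point phi).
Proof. by apply/funext => f; rewrite /C0_point; case: cid. Qed.

(* A function on [X] is in [C_BSE] when it is a BSE-function once transported to
   the character space of [C0]. *)
Definition C_BSE : set (X -> C) :=
  [set s | BSE_function (fun phi : char_space C0_alg => s (C0_point phi))].

Definition C_BSE_norm (s : X -> C) : R :=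
  BSE_norm (fun phi : char_space C0_alg => s (C0_point phi)).

End C0_characters.
Arguments C_BSE : clear implicits.
Arguments C_BSE_norm : clear implicits.

(* Main.v *)
Require Import Defs.
From mathcomp Require Import all_boot all_order all_algebra.
From mathcomp Require Import all_classical all_reals all_analysis.
From mathcomp Require Import complex ring.

Set Implicit Arguments.
Unset Strict Implicit.
Unset Printing Implicit Defensive.
Import Order.TTheory GRing.Theory Num.Theory.
Import numFieldNormedType.Exports.
Local Open Scope classical_set_scope.
Local Open Scope ring_scope.

(* [C_BSE X] is [C_b X] with the supremum norm: given [s] in [C_b X] and points
   [x_1, ..., x_n], multiplying [s] by a function [h] of [C_0 X] with values in
   [0, 1] and [h x_i = 1] gives an element of [C_0 X] that interpolates [s] and
   is bounded by [sup |s|], so any positive bound of [|s|] is a BSE bound; a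
   single point gives the converse.
   If a character [phi] of [C_b X] had no point [x] with [|a_i x - phi a_i|]
   small for [i = 1, ..., n], then [\sum_i |a_i - phi a_i|^2] would be bounded
   away from 0, hence invertible, although [phi] sends it to 0. So [phi] is a
   limit of evaluations, which also bounds [phi] by the norm. *)

(** * Real-valued modulus, limits and completeness in the complex numbers *)

Section Cplx_facts.
Variable R : realType.
Local Notation C := (Cplx R).

Lemma RtoC_gt0 (r : R) : (0 < RtoC r) = (0 < r).
Proof. exact: (RtoC_lt 0 r). Qed.

Lemma RtoC_ge0 (r : R) : (0 <= RtoC r) = (0 <= r).
Proof. exact: (RtoC_le 0 r). Qed.

(** In the order of [C], a positive element is a real number, so the [C]-valued radii of balls can
    be traded for radii in [R]. *)
Lemma gt0_RtoC (e : C) : 0 < e -> exists2 r : R, 0 < r & e = RtoC r.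
Proof.
move=> e0; exists (cmod e); last by rewrite -cmodE gtr0_norm.
by rewrite -RtoC_gt0 -cmodE gtr0_norm.
Qed.

Lemma cmod_RtoC (r : R) : 0 <= r -> cmod (RtoC r) = r.
Proof. by move=> r0; apply: RtoC_inj; rewrite -cmodE ger0_norm// RtoC_ge0. Qed.

Lemma cmodN (z : C) : cmod (- z) = cmod z.
Proof. by apply: RtoC_inj; rewrite -!cmodE normrN. Qed.

Lemma cmodBC (z w : C) : cmod (z - w) = cmod (w - z).
Proof. by rewrite -cmodN opprB. Qed.

Lemma cmod_conjC (z : C) : cmod (z^* : C) = cmod z.
Proof. by apply: RtoC_inj; rewrite -!cmodE norm_conjC. Qed.

Lemma cmod_le_ReIm (z : C) :
  cmod z <= `|complex.Re z| + `|complex.Im z|.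
Proof.
rewrite -RtoC_le -cmodE [z in `|z|]complexE RtoCD.
apply: (le_trans (ler_normD _ _)).
rewrite normrM !normc_def /= !expr0n /= !addr0 expr1n add0r !sqrtr_sqr sqrtr1.
by rewrite mul1r.
Qed.

Lemma cmod_ge_Re (z : C) : `|complex.Re z| <= cmod z.
Proof. by rewrite -RtoC_le -cmodE; exact: normc_ge_Re. Qed.

Lemma cmod_ge_Im (z : C) : `|complex.Im z| <= cmod z.
Proof.
rewrite -RtoC_le -cmodE normc_def /= RtoC_le -sqrtr_sqr ler_wsqrtr//.
by rewrite lerDr sqr_ge0.
Qed.

Lemma cvgCP T (F : set_system T) (FF : Filter F) (f : T -> C) (z : C) :
  f @ F --> z <->
  forall e : R, 0 < e -> \forall x \near F, cmod (z - f x) < e.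
Proof.
split=> [/cvgrPdist_lt fz e e0|fz].
  have /fz : 0 < RtoC e by rewrite RtoC_gt0.
  by apply: filterS => x; rewrite cmodE RtoC_lt.
apply/cvgrPdist_lt => _ /gt0_RtoC[e e0 ->].
by apply: filterS (fz e e0) => x; rewrite cmodE RtoC_lt.
Qed.

Lemma bounded_funCP T (f : T -> C) :
  bounded_fun f <-> exists M : R, forall x, cmod (f x) <= M.
Proof.
split=> [[M [Mr fM]]|[M fM]].
  (* [bounded_fun] gives a bound by each number above [M], not by [M] itself. *)
  have M1 : M < M + 1 by rewrite ltrDl.
  exists (cmod (M + 1)) => x; rewrite -RtoC_le -!cmodE.
  apply: le_trans (fM _ M1 x I) _; apply: real_ler_norm.
  by rewrite realD.
exists (RtoC M); split=> [|y My x _ /=].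
  by rewrite realE -[0]/(RtoC 0) !RtoC_le le_total.
by apply: ltW; rewrite (le_lt_trans _ My)// cmodE RtoC_le.
Qed.

(** Real and imaginary parts are 1-Lipschitz, so they send the filter to Cauchy filters on [R], and
    the two real limits are recombined. *)
Lemma Cplx_complete (F : set_system C) : ProperFilter F ->
  (forall e : R, 0 < e -> exists z, F [set w | cmod (z - w) < e]) ->
  exists z : C, F --> z.
Proof.
move=> PF Fc.
have cvg_part (p : C -> R) :
    (forall z w, `|p z - p w| <= cmod (z - w)) -> exists a : R, p @ F --> a.
  move=> pC; exists (lim (p @ F)).
  apply: cauchy_cvg; apply: cauchy_exP => e e0; have [z Fz] := Fc e e0.
  exists (p z); apply: (@filterS _ F _ _ _ _ Fz) => w.
  exact: le_lt_trans (pC z w).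
have [a /cvgrPdist_lt Fa] : exists a : R, (@complex.Re R) @ F --> a.
  by apply: cvg_part => z w; rewrite -raddfB; exact: cmod_ge_Re.
have [b /cvgrPdist_lt Fb] : exists b : R, (@complex.Im R) @ F --> b.
  by apply: cvg_part => z w; rewrite -raddfB; exact: cmod_ge_Im.
exists (a +i* b)%C; apply/(@cvgCP _ F _ id) => e e0.
have e20 : 0 < e / 2 by rewrite divr_gt0.
apply: filterS2 (Fa _ e20) (Fb _ e20) => -[x y] /= ax byy.
rewrite (le_lt_trans (cmod_le_ReIm _))//= [e]splitr.
exact: ltrD.
Qed.

End Cplx_facts.

(** * Identification of the BSE-functions with the bounded continuous functions *)

Section locally_compact.
Variables (R : realType) (X : topologicalType).
Hypothesis X_lc : locally_compact [set: X].
Hypothesis X_h : hausdorff_space X.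
Local Notation C := (Cplx R).
Local Notation C0_alg := (C0_alg R X).

Lemma continuous_RtoC (f : X -> R) : continuous f -> continuous (@RtoC R \o f).
Proof.
move=> cf x; apply/cvgCP => e e0; have /cvgrPdist_lt /(_ e e0) := cf x.
apply: filterS => y fxy; rewrite /= -RtoC_lt -cmodE -rmorphB /=.
by rewrite cmodE RtoC_lt (le_lt_trans (cmod_le_ReIm _))//= normr0 addr0.
Qed.

(** Complete regularity gives [f] that is 0 at [x] and 1 off the interior of [U] intersected with a
    compact neighbourhood [V]. The bump is [1 - f]; it vanishes off [V], hence at infinity. *)
Lemma bump_function (x : X) (U : set X) : nbhs x U ->
  exists h : X -> C, [/\ C0 h, h x = 1, forall y, 0 <= h y <= 1
                       & forall y, h y <> 0 -> U y].
Proof.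
move=> Ux; have [V] := @X_lc x I; rewrite withinET => Vx [cV clV].
pose W := (U `&` V)^°.
have Wx : W x by exact: filterI.
have : uniform_separator [set x] (~` W).
  have cW : closed (~` W) by exact/open_closedC/open_interior.
  apply: (locally_compact_completely_regular (R := R) X_lc X_h cW).
  by move=> /(_ Wx).
move=> /(@uniform_separatorP _ R)[f [cf f01 fx fW]].
have f01' y : 0 <= f y <= 1.
  by have := f01 (f y); rewrite /= in_itv /=; apply; exists y.
have W0 y : ~ W y -> f y = 1 by move=> Wy; apply: fW; exists y.
exists (fun y => RtoC (1 - f y)); split.
- apply: C0_dom => [|e e0].
    apply: (@continuous_RtoC (fun y => 1 - f y)) => y.
    by apply: cvgB; [exact: cvg_cst|exact: cf].
  exists V => // y /=; have [/interior_subset[]//|Wy] := pselect (W y).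
  by rewrite W0// subrr cmod0 leNgt e0.
- by rewrite (_ : f x = 0) ?subr0//; apply: fx; exists x.
- move=> y; rewrite RtoC_ge0 (RtoC_le _ 1); have := f01' y.
  by rewrite subr_ge0 gerBl andbC.
- move=> y; have [/interior_subset[]//|Wy] := pselect (W y).
  by rewrite W0// subrr => /(_ erefl).
Qed.

Lemma interpolating_bump (s : seq X) :
  exists h : X -> C, [/\ C0 h, forall y, 0 <= h y <= 1
                       & forall y, y \in s -> h y = 1].
Proof.
elim: s => [|x s [h [h0 h01 hs]]].
  by exists 0; split => [||//]; [exact: C00|move=> y; rewrite lexx ler01].
have [g [g0 gx g01 _]] := bump_function (filterT (F := nbhs x)).
have N := C0_normed_subalgebra R X.
have ghE y : (g + h - g * h) y = g y + h y - g y * h y by [].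
(* This is [1 - (1 - g) * (1 - h)]: it stays in [0, 1] and equals 1 wherever [g] or [h] does. *)
exists (g + h - g * h); split.
- rewrite -scaleN1r; apply: (nsubD N); first exact: (nsubD N).
  by apply: (nsubZ N); exact: (nsubM N).
- move=> y; have /andP[gy0 gy1] := g01 y; have /andP[hy0 hy1] := h01 y.
  have -> : (g + h - g * h) y = 1 - (1 - g y) * (1 - h y).
    by rewrite ghE; ring.
  rewrite subr_ge0 gerBl mulr_ge0 ?subr_ge0// andbT.
  by rewrite mulr_ile1 ?subr_ge0// gerBl.
- move=> y; rewrite ghE inE => /orP[/eqP ->|/hs ->].
    by rewrite gx mul1r addrK.
  by rewrite mulr1 addrC addKr.
Qed.

Lemma C0_point_inj (x y : X) :
  (forall f : C0_alg, val f x = val f y) -> x = y.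
Proof.
(* It suffices that any neighbourhoods [A] of [x] and [B] of [y] meet. They meet at [y]: a bump at
   [x] supported in [A] takes the value 1 at [y] too. *)
move=> xy; apply: X_h => A B Ax By.
have [h [h0 hx _ hA]] := bump_function Ax.
exists y; split; last exact: nbhs_singleton.
apply: hA; have /= := xy (Sub h (mem_set h0)); rewrite hx => <-.
exact/eqP/oner_neq0.
Qed.

Lemma point_eval_char (x : X) :
  char_space C0_alg (point_eval (C0_normed_subalgebra R X) x).
Proof.
split => //; have [h [h0 hx _ _]] := bump_function (filterT (F := nbhs x)).
exists (Sub h (mem_set h0)); rewrite /point_eval /= hx; exact/eqP/oner_neq0.
Qed.

(** With [C0_point], this realises the homeomorphism between [X] and the character space of [C0],
    along which continuity is transported. *)
Definition C0_eval (x : X) : char_space C0_alg :=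
  SigSub (mem_set (point_eval_char x)).

Lemma C0_evalK : cancel C0_eval (@C0_point R X).
Proof.
move=> x; apply: C0_point_inj => f.
by have /(congr1 (@^~ f)) := C0_pointE (C0_eval x).
Qed.

(** A bump [h] at [C0_point phi] supported in [U] defines a weak* neighbourhood of [phi]: if [psi]
    takes a value at distance less than 1 from 1 on [h], then [h] is non-zero at [C0_point psi],
    which thus lies in [U]. *)
Lemma continuous_C0_point : continuous (@C0_point R X).
Proof.
move=> phi U /= /bump_function[h [h0 hx _ hU]].
pose f : C0_alg := Sub h (mem_set h0).
have fE psi : val psi f = h (C0_point psi) by rewrite C0_pointE.
have cf : continuous (fun psi : char_space C0_alg => val psi f).
  move=> psi.
  have cval : continuous (val : char_space C0_alg -> {ptws C0_alg -> C}).
    exact: initial_continuous.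
  have cproj : continuous (fun p : {ptws C0_alg -> C} => p f).
    exact: proj_continuous.
  exact: (continuous_comp (cval psi) (cproj (val psi))).
have := @cmod_near _ _ _ phi 1 cf ltr01; apply: filterS => psi /=.
rewrite !fE hx => hpsi; apply: hU => h0'.
by move: hpsi; rewrite h0' subr0 cmod1 ltxx.
Qed.

Lemma continuous_C0_eval : continuous C0_eval.
Proof.
apply: continuous_comp_initial => x; apply/pointwise_cvgP => f.
by have [cf _] : C0 (val f) := fun_algP f; exact: cf.
Qed.

Lemma BSE_boundP (s : X -> C) (K : R) : continuous s ->
  BSE_bound (fun phi : char_space C0_alg => s (C0_point phi)) K <->
  0 < K /\ forall x, cmod (s x) <= K.
Proof.
move=> cs; split=> -[K0 sK]; split => //.
  (* One evaluation with coefficient 1 has dual norm at most 1. *)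
  move=> x; have := sK 1 (fun=> C0_eval x) (fun=> 1).
  rewrite big_ord1 C0_evalK mul1r -lee_fin => /le_trans; apply.
  rewrite -[leRHS]mule1 lee_wpmul2l// ?lee_fin ?(ltW K0)//.
  apply: ub_ereal_sup => _ [f f1 <-]; rewrite big_ord1 mul1r lee_fin.
  have : cmod (val f x) <= sup_norm (val f).
    by apply: sup_norm_ub; exact: fun_algP.
  move=> /le_trans; apply; move: f1.
  by rewrite /= fun_alg_normE (RtoC_le _ 1).
move=> n phi c.
have [h [h0 h01 h1]] :=
  interpolating_bump [seq C0_point (phi i) | i <- enum 'I_n].
have sh0 : C0 (s * h) by apply: C0M => //; exists K => _ [x _ <-]; exact: sK.
(* Dividing by [K] puts the interpolating function in the unit ball, so its value under the
   combination of characters is a lower bound for the dual norm. *)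
pose f : C0_alg := RtoC K^-1 *: Sub (s * h) (mem_set sh0).
have fE x : val f x = RtoC K^-1 * (s x * h x) by [].
have Kfs i : val (phi i) f = RtoC K^-1 * s (C0_point (phi i)).
  rewrite C0_pointE /point_eval fE h1 ?mulr1//.
  by apply/mapP; exists i; rewrite ?mem_enum.
have Ki : 0 <= K^-1 by rewrite invr_ge0 ltW.
apply: (@le_trans _ _
  (K%:E * (cmod (\sum_(i < n) c i * val (phi i) f))%:E)%E).
  under [in leRHS]eq_bigr do rewrite Kfs mulrCA.
  rewrite -mulr_sumr cmodM cmod_RtoC// -EFinM mulrA mulfV ?gt_eqF// mul1r.
  exact: lexx.
rewrite lee_wpmul2l// ?lee_fin ?(ltW K0)//.
apply: ereal_sup_ubound; exists f => //=.
rewrite fun_alg_normE (RtoC_le _ 1); apply: sup_norm_le => // x.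
rewrite fE cmodM cmod_RtoC// mulrC ler_pdivrMr// mul1r cmodM.
have h1x : cmod (h x) <= 1.
  have /andP[hx0 hx1] := h01 x.
  by rewrite -(RtoC_le _ 1) -cmodE ger0_norm.
by rewrite (le_trans _ (sK x))// ler_piMr ?cmod_ge0.
Qed.

Lemma C_BSE_Cb : C_BSE R X = Cb R X.
Proof.
apply/seteqP; split => s.
  move=> [[cs _] [K sK]].
  have cs' : continuous s.
    rewrite (_ : s = (fun phi => s (C0_point phi)) \o C0_eval).
      move=> x; apply: continuous_comp; first exact: continuous_C0_eval.
      exact: cs.
    by apply/funext => x; rewrite /= C0_evalK.
  split => //; apply/bounded_funCP; exists K.
  by have [] := (BSE_boundP K cs').1 sK.
move=> [cs /bounded_funCP[M sM]]; split; first split.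
- move=> phi; apply: (continuous_comp (@continuous_C0_point phi)); exact: cs.
- by apply/bounded_funCP; exists M.
(* A BSE bound must be positive, which [M] need not be. *)
- exists (Num.max M 1); apply/BSE_boundP => //; split.
    by rewrite lt_max ltr01 orbT.
  by move=> x; rewrite le_max sM.
Qed.

Lemma C_BSE_normE (s : X -> C) : Cb R X s -> C_BSE_norm R X s = sup_norm s.
Proof.
move=> [cs /bounded_funCP[M sM]].
have ub x : cmod (s x) <= sup_norm s.
  by apply: ub_le_sup; [exists M => _ [y _ <-]; exact: sM|exists x].
have s0 := sup_norm_ge0 s.
apply/le_anti/andP; split.
  (* For [s = 0] the supremum norm is not positive and so not a BSE bound; [sup_norm s + e] always
     is. *)
  apply/ler_addgt0Pr => e e0; apply: ge_inf.
    by exists 0 => K [/ltW].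
  apply/BSE_boundP => //; split; first exact: ltr_wpDl.
  by move=> x; rewrite (le_trans (ub x))// lerDl ltW.
apply: lb_le_inf.
  exists (sup_norm s + 1); apply/BSE_boundP => //; split; first exact: ltr_wpDl.
  by move=> x; rewrite (le_trans (ub x))// lerDl.
move=> K /(BSE_boundP K cs)[K0 sK].
by apply: sup_norm_le => //; exact: ltW.
Qed.

End locally_compact.

(** * Bounded continuous functions as a Banach algebra *)

Section bounded_continuous.
Variables (R : realType) (X : topologicalType).
Local Notation C := (Cplx R).
Implicit Types f g : X -> C.

Lemma sup_norm_geb f x : Cb R X f -> cmod (f x) <= sup_norm f.
Proof.
move=> [_ /bounded_funCP[M fM]].
by apply: ub_le_sup; [exists M => _ [y _ <-]; exact: fM|exists x].
Qed.

Lemma CbP f (M : R) : continuous f -> (forall x, cmod (f x) <= M) -> Cb R X f.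
Proof. by move=> cf fM; split => //; apply/bounded_funCP; exists M. Qed.

Lemma Cb_cst (c : C) : Cb R X (cst c).
Proof. by apply: (@CbP _ (cmod c)) => // x; exact: cvg_cst. Qed.

Lemma CbD f g : Cb R X f -> Cb R X g -> Cb R X (f + g).
Proof.
move=> bf bg; apply: (@CbP _ (sup_norm f + sup_norm g)) => x.
  by apply: cvgD; [exact: bf.1|exact: bg.1].
by rewrite (le_trans (cmodD _ _))// lerD ?sup_norm_geb.
Qed.

Lemma CbM f g : Cb R X f -> Cb R X g -> Cb R X (f * g).
Proof.
move=> bf bg; apply: (@CbP _ (sup_norm f * sup_norm g)) => x.
  by apply: cvgM; [exact: bf.1|exact: bg.1].
by rewrite cmodM ler_pM ?cmod_ge0 ?sup_norm_geb.
Qed.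

Lemma CbZ (c : C) f : Cb R X f -> Cb R X (c *: f).
Proof. by move=> bf; exact: CbM (Cb_cst c) bf. Qed.

Lemma Cb_conj f : Cb R X f -> Cb R X (fun x => (f x)^*).
Proof.
move=> bf; apply: (@CbP _ (sup_norm f)) => x; last first.
  by rewrite cmod_conjC sup_norm_geb.
apply/cvgCP => e e0; apply: filterS (cmod_near x bf.1 e0) => y.
by rewrite -rmorphB cmod_conjC.
Qed.

Lemma Cb_inv f (e : R) : 0 < e -> Cb R X f -> (forall x, e <= cmod (f x)) ->
  Cb R X (fun x => (f x)^-1).
Proof.
move=> e0 bf fe.
have f0 x : f x != 0.
  by apply/eqP => fx; have := fe x; rewrite fx cmod0 leNgt e0.
apply: (@CbP _ e^-1) => x; first by apply: cvgV => //; exact: bf.1.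
rewrite -(ler_pM2l e0) mulfV ?gt_eqF//.
by rewrite (le_trans (ler_wpM2r (cmod_ge0 _) (fe x)))// -cmodM mulfV// cmod1.
Qed.

(** The norm is known only on bounded continuous functions, since [C_BSE_norm] is compared with
    [sup_norm] only there. *)
Variable N : (X -> C) -> R.
Hypothesis NE : forall f, Cb R X f -> N f = sup_norm f.

Lemma Cb_normZ_le (c : C) f : Cb R X f ->
  sup_norm (c *: f) <= cmod c * sup_norm f.
Proof.
move=> bf; apply: sup_norm_le => [|x].
  by rewrite mulr_ge0 ?cmod_ge0 ?sup_norm_ge0.
by rewrite [leLHS]cmodM ler_wpM2l ?cmod_ge0 ?sup_norm_geb.
Qed.

Lemma Cb_normed_subalgebra : normed_subalgebra (Cb R X) N.
Proof.
split.
- exact: Cb_cst.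
- exact: CbD.
- exact: CbZ.
- exact: CbM.
- move=> f g bf bg; rewrite !NE//; last exact: CbD.
  apply: sup_norm_le => [|x]; first by rewrite addr_ge0 ?sup_norm_ge0.
  by rewrite (le_trans (cmodD _ _))// lerD ?sup_norm_geb.
- move=> c f bf; rewrite !NE//; last exact: CbZ.
  apply/le_anti; rewrite Cb_normZ_le//=; have [->|c0] := eqVneq c 0.
    by rewrite cmod0 mul0r sup_norm_ge0.
  (* The reverse inequality is [Cb_normZ_le] for the scalar [c^-1] and the function [c *: f]. *)
  rewrite -{1}[f](scalerK c0).
  rewrite (le_trans (ler_wpM2l (cmod_ge0 _)
    (Cb_normZ_le _ (CbZ c bf))))//.
  by rewrite mulrA -cmodM mulfV// cmod1 mul1r.
- move=> f bf; rewrite NE// => f0; apply/funext => x; apply/cmod_eq0/le_anti.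
  by rewrite cmod_ge0 -f0 sup_norm_geb.
- move=> f g bf bg; rewrite !NE//; last exact: CbM.
  apply: sup_norm_le => [|x]; first by rewrite mulr_ge0 ?sup_norm_ge0.
  by rewrite cmodM ler_pM ?cmod_ge0 ?sup_norm_geb.
Qed.

(** The type [fun_alg h] depends on the proof [h]. Keeping [h] arbitrary covers also the proof
    projected from a [banach_function_algebra]. *)
Variable h : normed_subalgebra (Cb R X) N.
Local Notation A := (fun_alg h).

Lemma Cb_algP (a : A) : Cb R X (val a).
Proof. exact: fun_algP. Qed.

Lemma Cb_norm_ge (a : A) x : cmod (val a x) <= N (val a).
Proof. by rewrite NE ?sup_norm_geb//; exact: Cb_algP. Qed.

Lemma Cb_norm_le (a : A) (M : R) : 0 <= M -> (forall x, cmod (val a x) <= M) ->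
  N (val a) <= M.
Proof. by move=> M0 aM; rewrite NE ?sup_norm_le//; exact: Cb_algP. Qed.

(** The pointwise limit exists by completeness of [C]; the Cauchy condition makes the convergence
    uniform, so the limit is bounded and continuous. *)
Lemma Cb_complete (F : set_system A) : ProperFilter F -> cauchy F -> cvg F.
Proof.
move=> PF Fc.
have {}Fc (e : R) : 0 < e ->
    exists a : A, F [set b | forall x, cmod (val a x - val b x) < e].
  move=> e0; have e0' : 0 < RtoC e by rewrite RtoC_gt0.
  have [a Fa] := (cauchyP F).1 Fc _ e0'; exists a.
  apply: filterS Fa => b; rewrite -ball_normE /= fun_alg_normE RtoC_lt => ab x.
  exact: le_lt_trans (Cb_norm_ge (a - b) x) ab.
have Fx x : exists z : C, (fun a : A => val a x) @ F --> z.
  apply: Cplx_complete => e /Fc[a Fa]; exists (val a x).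
  by apply: (@filterS _ F _ _ _ _ Fa) => b /(_ x).
have [s sF] := choice Fx.
have sU (e : R) : 0 < e -> F [set b | forall x, cmod (s x - val b x) <= e].
  move=> e0; have e20 : 0 < e / 2 by rewrite divr_gt0.
  have [a Fa] := Fc _ e20; apply: (filterS _ Fa) => b ab x.
  (* At the fixed point [x], pass through some [b'] that is uniformly [e / 2]-close to [a] and
     [d]-close to [s] at [x]. Such a [b'] depends on [x], but the resulting bound [e + d] does
     not. *)
  apply/ler_addgt0Pr => d d0.
  have sd : F [set b' | cmod (s x - val b' x) < d].
    by apply: (cvgCP _ _ _).1 d d0; exact: sF.
  have [b' [ab' sb']] := filter_ex (filterI Fa sd).
  have -> : s x - val b x =
      (s x - val b' x) + ((val b' x - val a x) + (val a x - val b x)) by ring.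
  have le1 : cmod ((val b' x - val a x) + (val a x - val b x)) <= e.
    rewrite (le_trans (cmodD _ _))// [e]splitr (cmodBC (val b' x)).
    by have := lerD (ltW (ab' x)) (ltW (ab x)).
  by rewrite (le_trans (cmodD _ _))// addrC lerD// ltW.
have bs : Cb R X s.
  have [b sb] := filter_ex (sU 1 ltr01).
  apply: (@CbP _ (1 + N (val b))) => [x|x]; last first.
    rewrite -[s x](subrK (val b x)) (le_trans (cmodD _ _))// lerD//.
    exact: Cb_norm_ge.
  apply/cvgCP => e e0; have e30 : 0 < e / 3 by rewrite divr_gt0.
  have {sb}[c sc] := filter_ex (sU _ e30).
  apply: filterS (cmod_near x (Cb_algP c).1 e30) => y cxy.
  have -> : s x - s y =
      (s x - val c x) + ((val c x - val c y) + (val c y - s y)) by ring.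
  (* Uniform limit argument: two terms compare [s] with [c], the middle one uses the continuity of
     [c]. *)
  have -> : e = e / 3 + (e / 3 + e / 3) by field.
  rewrite (le_lt_trans (cmodD _ _))// ler_ltD//.
  rewrite (le_lt_trans (cmodD _ _))// ltr_leD//.
  by rewrite cmodBC.
apply/cvg_ex; exists (Sub s (mem_set bs) : A).
apply/(@cvgrPdist_le _ _ _ F _ id) => _ /gt0_RtoC[e e0 ->].
apply: filterS (sU e e0) => b sb; rewrite fun_alg_normE RtoC_le.
by apply: Cb_norm_le => //; exact: ltW.
Qed.

End bounded_continuous.

(** * Closures and limits in the weak* topology *)

Section dual_space.
Variables (R : realType) (A : commNormedAlgType (Cplx R)).
Local Notation C := (Cplx R).

(** Serves to carry algebraic identities from evaluations to their weak* limits. *)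
Lemma closure_eq_cst (T : topologicalType) (F : T -> C) (W : set T) (c : C) :
  continuous F -> (forall q, W q -> F q = c) ->
  forall p, closure W p -> F p = c.
Proof.
move=> cF FW p Wp; apply/subr0_eq/eqP/negP => /negP Fc.
have Fc0 : 0 < cmod (F p - c).
  by rewrite lt_def cmod_ge0 andbT; apply: contra_neq Fc => /cmod_eq0.
have [q [/FW Fq]] := Wp _ (cmod_near p cF Fc0).
by rewrite /= Fq ltxx.
Qed.

Lemma continuous_dual_eval (a : A) :
  continuous (fun p : dual A => (val p : A -> C) a).
Proof.
move=> p; have cval : continuous (val : dual A -> {ptws A -> C}).
  exact: initial_continuous.
have cproj : continuous (fun p : {ptws A -> C} => p a).
  exact: proj_continuous.
exact: (continuous_comp (cval p) (cproj (val p))).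
Qed.

(** Weak* convergence is pointwise convergence. As the closure is taken inside [dual A], both [phi]
    and the approximating functionals have to be continuous. *)
Lemma cvg_weak_star_closure T (G : set_system T) (f : T -> dual A)
    (phi : {ptws A -> C}) (S : set {ptws A -> C}) :
  ProperFilter G -> dual A phi -> (forall t, S (val (f t))) ->
  (forall a, val (f t) a @[t --> G] --> phi a) -> weak_star_closure S phi.
Proof.
move=> PG dphi fS fphi; exists (SigSub (mem_set dphi)) => // B.
move=> [_ [[U oU <-] Uphi] UB].
have cvf : (val \o f : T -> {ptws A -> C}) @ G --> phi by apply/pointwise_cvgP.
have : G ((val \o f) @^-1` U) by apply: cvf; exact: open_nbhs_nbhs.
move=> /filter_ex[t Ut].
by exists (f t); split; [exact: fS|exact: UB].
Qed.

End dual_space.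

(** * Characters of the algebra of bounded continuous functions *)

Section bounded_continuous_characters.
Variables (R : realType) (X : topologicalType).
Local Notation C := (Cplx R).
Variable N : (X -> C) -> R.
Hypothesis NE : forall f, Cb R X f -> N f = sup_norm f.
Variable h : normed_subalgebra (Cb R X) N.
Hypothesis X0 : [set: X] !=set0.
Local Notation A := (fun_alg h).

Definition Cb_one : A := Sub (cst 1) (mem_set (Cb_cst X 1)).

Lemma Cb_unital : unital A.
Proof.
exists Cb_one; split.
  by move=> a; apply: val_inj; apply/funext => x; exact: mul1r.
(* A point of [X] is needed for the norm of the constant 1 to be at least 1. *)
have [x _] := X0; rewrite fun_alg_normE; congr (_%:C)%C.
apply/le_anti/andP; split.
  by apply: (Cb_norm_le NE) => // y; rewrite cmod1.
by rewrite -(@cmod1 R); exact: (Cb_norm_ge NE Cb_one x).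
Qed.

Lemma norm_point_eval x (a : A) : cmod (point_eval h x a) <= N (val a).
Proof. exact: Cb_norm_ge. Qed.

Lemma dual_of_bound (phi : A -> C) : scalar phi ->
  (forall a, cmod (phi a) <= N (val a)) -> dual A phi.
Proof.
move=> phiL phiN; split => // a.
apply/(@cvgCP _ _ _ (nbhs_filter (a : A))) => e e0.
have e0' : 0 < RtoC e by rewrite RtoC_gt0.
apply: filterS (nbhsx_ballx a _ e0') => b.
rewrite -ball_normE /= fun_alg_normE RtoC_lt.
apply: le_lt_trans.
suff -> : phi a - phi b = phi (a - b) by [].
by rewrite [in RHS]addrC -(scaleN1r b) phiL mulN1r addrC.
Qed.

Lemma point_eval_dual x : dual A (point_eval h x).
Proof. by apply: dual_of_bound => // a; exact: norm_point_eval. Qed.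

Lemma closure_point_eval_char :
  weak_star_closure (range (point_eval h)) `<=` char_space A.
Proof.
move=> _ [p clp <-]; have [pL _] : dual A (val p) := set_valP p.
split => //.
  move=> a b; apply/subr0_eq.
  apply: (@closure_eq_cst _ _ (fun p : dual A =>
    val p (amul a b) - val p a * val p b) _ 0 _ _ p clp).
    have cq c := @continuous_dual_eval _ A c.
    move=> q; exact: (continuousB (cq _ q) (continuousM (cq _ q) (cq _ q))).
  by move=> q [x _ <-]; rewrite /= subrr.
(* Being non-zero is not a closed condition, but the value 1 at the unit is, and it survives in the
   limit. *)
exists Cb_one; rewrite (_ : val p Cb_one = 1); first exact/eqP/oner_neq0.
apply: (@closure_eq_cst _ _ (fun p : dual A => val p Cb_one) _ 1 _ _ p clp).
  exact: continuous_dual_eval.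
by move=> q [x _ <-].
Qed.

Section character.
Variable phi : A -> C.
Hypothesis phi_char : char_space A phi.

Let phiL : scalar phi. Proof. by case: phi_char. Qed.
Let phiM : {morph phi : f g / amul f g >-> f * g}.
Proof. by case: phi_char. Qed.

Let phiD f g : phi (f + g) = phi f + phi g.
Proof. by have := phiL 1 f g; rewrite scale1r mul1r. Qed.

Let phi1 : phi Cb_one = 1.
Proof.
have [_ _ [a /eqP a0]] := phi_char; apply: (mulIf a0).
rewrite -phiM mul1r; congr phi; apply: val_inj; apply/funext => x; exact: mul1r.
Qed.

(** The sets [Z (g, e)], where a non-negative [g] killed by [phi] is smaller than [e], form the base
    of a filter [G] on [X] along which the evaluations converge to [phi]. *)
Let P := [set ge : A * R |
  [/\ phi ge.1 = 0, forall x, 0 <= val ge.1 x & 0 < ge.2]].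
Let Z (ge : A * R) := [set x | cmod (val ge.1 x) < ge.2].

(** Otherwise [g] is bounded below by [e], so it has a bounded continuous inverse, and [phi g = 0]
    contradicts [phi Cb_one = 1]. *)
Let Z_nonempty ge : P ge -> Z ge !=set0.
Proof.
case: ge => g e [/= g0 _ e0]; apply: contrapT => Zge.
have ge x : e <= cmod (val g x).
  by rewrite leNgt; apply/negP => gx; apply: Zge; exists x.
pose g' : A := Sub (fun x => (val g x)^-1)
  (mem_set (Cb_inv e0 (Cb_algP g) ge)).
have : phi (amul g g') = 0 by rewrite phiM g0 mul0r.
suff -> : amul g g' = Cb_one by rewrite phi1 => /eqP; rewrite oner_eq0.
apply: val_inj; apply/funext => x; apply: mulfV; apply/eqP => gx.
by have := ge x; rewrite gx cmod0 leNgt e0.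
Qed.

Let G := filter_from P Z.

Let G_proper : ProperFilter G.
Proof.
apply: filter_from_proper => //; apply: filter_from_filter.
  exists (0, 1); split => //=.
  by have := phiL (-1) 0 0; rewrite scaler0 addr0 mulN1r addNr.
move=> [f d] [g e] [f0 fp d0] [g0 gp e0].
have le (u v : C) : 0 <= u -> 0 <= v -> cmod u <= cmod (u + v).
  by move=> u0 v0; rewrite -RtoC_le -!cmodE !ger0_norm ?addr_ge0// lerDl.
(* By non-negativity [f] and [g] are both at most [f + g]. *)
exists (f + g, Num.min d e).
  split => /=; first by rewrite phiD f0 g0 addr0.
    by move=> x; exact: addr_ge0 (fp x) (gp x).
  by rewrite lt_min d0 e0.
move=> x; rewrite /Z /= lt_min => /andP[fd ge]; split.
  exact: le_lt_trans (le _ _ (fp x) (gp x)) fd.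
by apply: le_lt_trans ge; rewrite addrC; exact: le _ _ (gp x) (fp x).
Qed.

Let G_cvg (a : A) : val a x @[x --> G] --> phi a.
Proof.
have PG := G_proper; apply/cvgCP => e e0.
pose b := a - phi a *: Cb_one.
have bE x : val b x = val a x - phi a.
  by rewrite -[phi a in RHS]mulr1.
have phib : phi b = 0 by rewrite /b addrC -scaleNr phiL phi1 mulr1 addNr.
pose b' : A := Sub (fun x => (val b x)^*)
  (mem_set (Cb_conj (Cb_algP b))).
have bb'E x : val (amul b b') x = `|val b x| ^+ 2 by rewrite normCK.
(* The product of [b] and its conjugate is the square of the modulus of [a - phi a], hence the
   radius [e ^+ 2]. *)
exists (amul b b', e ^+ 2).
  split => /=; first by rewrite phiM phib mul0r.
    by move=> x; rewrite -[leRHS]/(val (amul b b') x) bb'E exprn_ge0.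
  by rewrite exprn_gt0.
move=> x bx; have {bx} : cmod (val (amul b b') x) < e ^+ 2 := bx.
rewrite bb'E cmodE expr2 -RtoCM cmod_RtoC ?mulr_ge0 ?cmod_ge0//.
by rewrite -expr2 ltr_pXn2r ?nnegrE ?cmod_ge0 ?(ltW e0)// bE cmodBC.
Qed.

Lemma char_closure_point_eval :
  weak_star_closure (range (point_eval h)) phi.
Proof.
have PG := G_proper.
apply: (cvg_weak_star_closure (G := G)
  (f := fun x => SigSub (mem_set (point_eval_dual x)))) => //.
(* Automatic continuity: [phi a] is within [e] of a value of [a], whose modulus is at most the norm
   of [a]. *)
apply: dual_of_bound => // a; apply/ler_addgt0Pr => e e0.
have [x ax] := filter_ex ((cvgCP _ _ _).1 (@G_cvg a) e e0).
rewrite -[phi a](subrK (val a x)) addrC (le_trans (cmodD _ _))//.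
by rewrite lerD ?(ltW ax)//; exact: norm_point_eval.
Qed.

End character.

Lemma char_space_Cb :
  char_space A = weak_star_closure (range (point_eval h)).
Proof.
apply/seteqP; split; last exact: closure_point_eval_char.
by move=> phi; exact: char_closure_point_eval.
Qed.

End bounded_continuous_characters.

Theorem theorem2p1 (R : realType) (X : topologicalType)
    (X_nonempty : [set: X] !=set0) (X_hausdorff : hausdorff_space X)
    (X_locally_compact : locally_compact [set: X]) :
  exists h : banach_function_algebra (C_BSE R X) (C_BSE_norm R X),
    unital (fun_alg h) /\
    char_space (fun_alg h) = weak_star_closure (range (point_eval h)).
Proof.
have NE f : Cb R X f -> C_BSE_norm R X f = sup_norm f by exact: C_BSE_normE.
rewrite (C_BSE_Cb R X_locally_compact X_hausdorff).
have h : banach_function_algebra (Cb R X) (C_BSE_norm R X).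
  apply: (@Build_banach_function_algebra _ _ _ _ (Cb_normed_subalgebra NE)).
  - by [].
  - move=> x y xy; apply: contrapT => nf; apply: xy.
    (* Functions vanishing at infinity already separate points, and they are bounded. *)
    apply: (C0_point_inj (R := R) X_locally_compact X_hausdorff) => f.
    apply: contrapT => fxy; apply: nf; exists (val f) => //.
    have f0 : C0 (val f) := fun_algP f.
    by apply: (CbP f0.1) => z; exact: sup_norm_ub.
  - move=> x; exists (cst 1%R); first exact: Cb_cst.
    exact/eqP/oner_neq0.
  - exact: Cb_complete.
exists h; split; first exact: Cb_unital.
exact: char_space_Cb.
Qed.
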